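(* For a ring $R$, the following statements hold: (a) If $M$ is a weakly uniserial right $R$-module, then $|{\rm Ass}(M)|\leq 1$. Moreover, if $R$ satisfies the ascending chain condition on two-sided ideals, then $|{\rm Ass}(M)|=1$. (b) If $M$ is a weakly uniserial right $R$-module and $N \subseteq M$ is a submodule which is a prime $R$-module, then ${\rm Ann}_{R}(N)$ is a maximal member in the set $\{{\rm Ann}_{R}(K) \mid 0\neq K\subseteq M\}$, where $K$ ranges over submodules of $M$. (c) A weakly uniserial right $R$-module $M$ is weakly prime if and only if it is semiprime. (d) A right (respectively, left) weakly uniserial ring $R$ is prime if and only if it is semiprime.
   Context: All rings have identity elements and all modules are unitary right modules unless stated otherwise. A module $M$ is called weakly uniserial if for any two submodules $N$ and $K$ of $M$ there exists an injective module homomorphism $N\to K$ or an injective module homomorphism $K\to N$. A ring $R$ is right (respectively, left) weakly uniserial if it is weakly uniserial as a right (respectively, left) module over itself. For a right $R$-module $N$, ${\rm Ann}_R(N)$ denotes the annihilator of $N$ in $R$. A right $R$-module $M$ is called prime if $M\neq 0$ and ${\rm Ann}_R(M)={\rm Ann}_R(N)$ for any nonzero submodule $N$ of $M$. A two-sided ideal $P$ of $R$ is called an associated prime of $M$ if there exists a submodule $N\subseteq M$ such that $P={\rm Ann}_R(N)$ and $N$ is a prime $R$-module; ${\rm Ass}(M)$ denotes the set of associated primes of $M$. The module $M$ is called semiprime (respectively, weakly prime) if ${\rm Ann}_R(N)$ is a semiprime (respectively, prime) ideal of $R$ for any nonzero submodule $N$ of $M$.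
   Formalization: In the ''Moreover'' of (a), M is assumed nonzero, since the zero module is weakly uniserial and has no associated primes; the ring R is assumed nonzero, since the zero ring is semiprime but not prime in (d). *)

(* Defs.v *)
From mathcomp Require Import all_boot all_algebra.
From mathcomp Require Import boolp classical_sets functions cardinality.

Set Implicit Arguments.
Unset Strict Implicit.
Unset Printing Implicit Defensive.

Import GRing.Theory.

Local Open Scope classical_set_scope.
Local Open Scope ring_scope.

(* MathComp modules are left modules, so a right module over R is an
   [lmodType R^c], where R^c is the opposite ring of R (same carrier):
   [(r : R^c) *: x] is the element usually written "x r".  As a module over
   itself, R is R^o : lmodType R on the left and R^c^o : lmodType R^c on the
   right. *)

Section Modules.
Variables (S : nzRingType) (M : lmodType S).

(* [mem N] is the boolean predicate (by excluded middle) underlying the set N;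
   [submod_closed] means containing 0 and closed under a *: u + v. *)
Definition submodule (N : set M) : Prop := submod_closed (mem N).

Definition nonzero_submodule (N : set M) : Prop := submodule N /\ N <> [set 0].

(* The homomorphism N -> K is represented by a total function on M, whose
   values outside N are irrelevant. *)
Definition embeds (N K : set M) : Prop :=
  exists f : M -> M,
    [/\ set_fun N K f,
        set_inj N f
      & forall (a : S) (x y : M), N x -> N y -> f (a *: x + y) = a *: f x + f y].

Definition weakly_uniserial : Prop :=
  forall N K : set M, submodule N -> submodule K -> embeds N K \/ embeds K N.

End Modules.

Arguments weakly_uniserial {S} M.

Definition right_weakly_uniserial (R : nzRingType) : Prop :=
  weakly_uniserial (R^c^o : lmodType R^c).

Definition left_weakly_uniserial (R : nzRingType) : Prop :=
  weakly_uniserial (R^o : lmodType R).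

Section Ideals.
Variable R : nzRingType.

(* Two-sided, not necessarily proper, ideals. *)
Definition is_ideal (I : set R) : Prop :=
  [/\ I 0,
      forall x y, I x -> I y -> I (x - y)
    & forall a x, I x -> I (a * x) /\ I (x * a)].

Definition ideal_mul (I J : set R) : set R :=
  [set x | exists (n : nat) (a b : 'I_n -> R),
      [/\ forall i, I (a i), forall i, J (b i) & x = \sum_(i < n) a i * b i]].

Definition is_prime_ideal (P : set R) : Prop :=
  [/\ is_ideal P,
      P <> setT
    & forall I J : set R, is_ideal I -> is_ideal J ->
        ideal_mul I J `<=` P -> I `<=` P \/ J `<=` P].

Definition is_semiprime_ideal (P : set R) : Prop :=
  is_ideal P /\
  forall I : set R, is_ideal I -> ideal_mul I I `<=` P -> I `<=` P.

Definition acc_ideals : Prop :=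
  forall I : nat -> set R,
    (forall n, is_ideal (I n)) -> (forall n, I n `<=` I n.+1) ->
    exists n, forall m, (n <= m)%N -> I m = I n.

End Ideals.

Definition prime_ring (R : nzRingType) : Prop := is_prime_ideal [set (0 : R)].

Definition semiprime_ring (R : nzRingType) : Prop :=
  is_semiprime_ideal [set (0 : R)].

Section RightModules.
Variables (R : nzRingType) (M : lmodType R^c).

Definition Ann (N : set M) : set R :=
  [set r | forall x, N x -> (r : R^c) *: x = 0].

(* The submodule N is prime as a right R-module; its submodules are the
   submodules of M contained in N. *)
Definition prime_submodule (N : set M) : Prop :=
  nonzero_submodule N /\
  forall K : set M, nonzero_submodule K -> K `<=` N -> Ann N = Ann K.

Definition associated_prime (P : set R) : Prop :=
  is_ideal P /\ exists N : set M, prime_submodule N /\ P = Ann N.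

Definition Ass : set (set R) := [set P | associated_prime P].

Definition semiprime_module : Prop :=
  forall N : set M, nonzero_submodule N -> is_semiprime_ideal (Ann N).

Definition weakly_prime_module : Prop :=
  forall N : set M, nonzero_submodule N -> is_prime_ideal (Ann N).

Definition Ann_nonzero_submodules : set (set R) :=
  [set Ann K | K in [set K : set M | nonzero_submodule K]].

End RightModules.

Arguments Ass {R} M.
Arguments semiprime_module {R} M.
Arguments weakly_prime_module {R} M.
Arguments Ann_nonzero_submodules {R} M.

Definition maximal_member (T : Type) (F : set (set T)) (A : set T) : Prop :=
  F A /\ forall B, F B -> A `<=` B -> B = A.

(* Main.v *)
Require Import Defs.
From mathcomp Require Import all_boot all_algebra.
From mathcomp Require Import boolp classical_sets functions cardinality.

(** An embedding of a submodule N into K gives Ann K `<=` Ann N, so in a weakly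
    uniserial module the annihilators of submodules form a chain.  If N is
    prime and K is nonzero, then K either receives a copy of N or is isomorphic
    to a nonzero submodule of N, so Ann N is even the greatest annihilator of a
    nonzero submodule; this gives (b) and the bound in (a), while under the
    ascending chain condition a maximal annihilator of a nonzero submodule is
    an associated prime.  For (c), let the product IJ of two ideals kill N, where
    Ann N is semiprime.  The square of I `&` J lies in IJ, so
    I `&` J, and with it JI, kills N too.  Compare the annihilators of the
    submodules of N killed by I and by J, which contain NJ and NI: one of these
    annihilators contains both ideals, so the square of I or of J kills N.
    Part (d) is (c) for the submodule R of R. *)

Import GRing.Theory.

Local Open Scope classical_set_scope.
Local Open Scope card_scope.
Local Open Scope ring_scope.

(** * Ideals and the ascending chain condition *)

Section Ideals.
Context {R : nzRingType}.
Implicit Types P I J : set R.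

Lemma ideal_mul_subE P I J : is_ideal P ->
  ideal_mul I J `<=` P <-> forall a b, I a -> J b -> P (a * b).
Proof.
move=> [P0 PB _]; split=> [sIJP a b Ia Jb | IJP _ [n [a [b [Ia Jb ->]]]]].
  apply: sIJP; exists 1%N, (fun=> a), (fun=> b).
  by split=> //; rewrite big_ord1.
have PD x y : P x -> P y -> P (x + y).
  move=> Px Py; rewrite -[y]opprK; apply: (PB) => //.
  by rewrite -sub0r; apply: PB.
by apply: (big_ind P) => // i _; apply: IJP.
Qed.

Lemma is_ideal_setI I J : is_ideal I -> is_ideal J -> is_ideal (I `&` J).
Proof.
move=> [I0 IB IM] [J0 JB JM]; split=> // [x y [Ix Jx] [Iy Jy]|a x [Ix Jx]].
  by split; [exact: IB | exact: JB].
by have [? ?] := IM a x Ix; have [? ?] := JM a x Jx.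
Qed.

Lemma prime_ideal_semiprime P : is_prime_ideal P -> is_semiprime_ideal P.
Proof. by move=> [idP _ prP]; split=> // I idI /(prP I I idI idI) []. Qed.

(** Otherwise every member of [F] lies strictly inside another; iterating a choice of such a
    successor from [I0] gives an ascending chain that never stabilises. *)
Lemma exists_maximal_ideal (F : set (set R)) : acc_ideals R ->
  (forall I, F I -> is_ideal I) -> F !=set0 -> exists P, maximal_member F P.
Proof.
move=> accR idF [I0 FI0]; apply: contrapT => noMax.
have step (I : {I | F I}) :
    exists J : {J | F J}, sval I `<=` sval J /\ sval J <> sval I.
  case: I => I FI /=; apply: contrapT => noJ; apply: noMax; exists I.
  split=> // J FJ sIJ; apply: contrapT => neqJI.
  by apply: noJ; exists (exist _ J FJ).
have [next nextP] := choice step.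
pose C n := sval (iter n next (exist _ I0 FI0)).
have [||n Cn] := accR C.
- by move=> n; apply: idF; apply: svalP.
- by move=> n; case: (nextP (iter n next (exist _ I0 FI0))).
by case: (nextP (iter n next (exist _ I0 FI0))) => _; apply; apply: (Cn n.+1).
Qed.

End Ideals.

(** * Passage to the opposite ring *)

Section ConverseRing.
Context {R : nzRingType}.
Implicit Types P I : set R.

(** For right modules the general results on [annihilator] concern ideals of [R^c], whereas the
    theorem concerns ideals of [R]; this lemma and the next two translate. *)
Lemma is_ideal_converse I : @is_ideal R^c I <-> is_ideal I.
Proof. by split=> [][I0 IB IM]; split=> // a x /(IM a) []. Qed.

Lemma semiprime_ideal_converse P : is_semiprime_ideal P -> @is_semiprime_ideal R^c P.
Proof.
move=> [idP spP]; split=> [|I /is_ideal_converse idI]; first exact/is_ideal_converse.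
move/ideal_mul_subE => /(_ (proj2 (is_ideal_converse P) idP)) IIP.
by apply: spP => //; apply/ideal_mul_subE => // a b Ia Ib; apply: (IIP b a).
Qed.

Lemma prime_ideal_converse P : @is_prime_ideal R^c P -> is_prime_ideal P.
Proof.
move=> [idcP PT prP]; have /is_ideal_converse idP := idcP.
split=> // I J idI idJ /ideal_mul_subE => /(_ idP) IJP.
(* Products in [R^c] are reversed, so [I] and [J] exchange roles. *)
suff: J `<=` P \/ I `<=` P by move=> []; [right|left].
apply: prP; try exact/is_ideal_converse.
by apply/ideal_mul_subE => // a b Ja Ib; apply: (IJP b a).
Qed.

End ConverseRing.

(** * Submodules, embeddings and annihilators *)

Section Annihilators.
Context {S : nzRingType} {M : lmodType S}.
Implicit Types N K : set M.

(* For S = R^c this is convertible to [Ann]; an arbitrary S is allowed because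
   the left case of (d) needs S = R, and R^c^c is not convertible to R. *)
Definition annihilator N : set S := [set r | forall x, N x -> r *: x = 0].

Lemma submoduleP N :
  submodule N <-> N 0 /\ forall a x y, N x -> N y -> N (a *: x + y).
Proof.
split=> [[/set_mem N0 NL]|[N0 NL]]; split=> //.
- by move=> a x y Nx Ny; apply: set_mem; apply: NL; apply: mem_set.
- exact: mem_set.
- by move=> a x y /set_mem Nx /set_mem Ny; apply: mem_set; apply: NL.
Qed.

Lemma submoduleZ N a x : submodule N -> N x -> N (a *: x).
Proof. by move=> /submoduleP [N0 NL] Nx; rewrite -[_ *: _]addr0; apply: NL. Qed.

Lemma submoduleT : submodule [set: M].
Proof. exact/submoduleP. Qed.

Lemma nonzero_submoduleP N :
  nonzero_submodule N <-> submodule N /\ exists2 x, N x & x <> 0.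
Proof.
split=> [[sN N0]|[sN [x Nx x0]]]; split=> //; last by move=> N0; rewrite N0 in Nx.
apply: contrapT => noX; apply: N0; apply/seteqP; split=> [x Nx|_ ->].
  by apply: contrapT => x0; apply: noX; exists x.
by have /submoduleP [] := sN.
Qed.

Lemma nonzero_submoduleT :
  (exists x : M, x <> 0) -> nonzero_submodule [set: M].
Proof.
by move=> [x x0]; apply/nonzero_submoduleP; split; [exact: submoduleT | exists x].
Qed.

Lemma annihilator_ideal N : submodule N -> is_ideal (annihilator N).
Proof.
move=> sN; split=> [x _|a b aN bN x Nx|a b bN]; first exact: scale0r.
  by rewrite scalerBl aN // bN // subrr.
split=> x Nx; rewrite -scalerA; first by rewrite bN // scaler0.
by apply: bN; apply: submoduleZ.
Qed.

Lemma annihilatorS N K : N `<=` K -> annihilator K `<=` annihilator N.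
Proof. by move=> sNK r rK x /sNK; apply: rK. Qed.

Lemma annihilator_proper N : nonzero_submodule N -> annihilator N <> setT.
Proof.
move=> /nonzero_submoduleP [_ [x Nx x0]] NT; apply: x0.
by rewrite -[x]scale1r; have : annihilator N 1 by [rewrite NT]; apply.
Qed.

Lemma embedding_fun0 {N} {f : M -> M} : submodule N ->
  (forall a x y, N x -> N y -> f (a *: x + y) = a *: f x + f y) -> f 0 = 0.
Proof.
move=> /submoduleP [N0 _] /(_ 1 0 0 N0 N0); rewrite !scale1r addr0 => f0.
by apply: (addrI (f 0)); rewrite addr0 -f0.
Qed.

Lemma embedding_funZ {N} {f : M -> M} a x : submodule N ->
  (forall a x y, N x -> N y -> f (a *: x + y) = a *: f x + f y) ->
  N x -> f (a *: x) = a *: f x.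
Proof.
move=> sN fL Nx; have [N0 _] := proj1 (submoduleP N) sN.
by rewrite -[a *: x]addr0 fL // (embedding_fun0 sN fL) addr0.
Qed.

(** If [r] kills [K], then [f (r *: x) = r *: f x = 0 = f 0] for [x] in [N], and injectivity gives
    [r *: x = 0]. *)
Lemma embeds_annihilator N K : submodule N -> embeds N K ->
  annihilator K `<=` annihilator N.
Proof.
move=> sN [f [fK finj fL]] r rK x Nx; have [N0 NL] := proj1 (submoduleP N) sN.
have f0 := embedding_fun0 sN fL.
apply: finj; [exact/mem_set/(submoduleZ _ _ _ sN) | exact: mem_set |].
by rewrite (embedding_funZ _ _ sN fL) // f0 rK //; apply: fK.
Qed.

(** The witness is the image of [N], which is nonzero because [f] is injective with [f 0 = 0]. *)
Lemma embeds_image N K : nonzero_submodule N -> embeds N K ->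
  exists L, [/\ nonzero_submodule L, L `<=` K & annihilator N `<=` annihilator L].
Proof.
move=> /nonzero_submoduleP [sN [x0 Nx0 x0N0]] [f [fK finj fL]].
have [N0 NL] := proj1 (submoduleP N) sN; have f0 := embedding_fun0 sN fL.
exists (f @` N); split=> [| _ [x Nx <-] |]; [|exact: fK|].
  apply/nonzero_submoduleP; split; last first.
    exists (f x0); first by exists x0.
    by rewrite -f0 => /finj e; apply: x0N0; apply: e; apply: mem_set.
  apply/submoduleP; split; first by exists 0.
  move=> a _ _ [x Nx <-] [y Ny <-]; exists (a *: x + y); last exact: fL.
  exact: NL.
move=> r rN _ [x Nx <-].
by rewrite -(embedding_funZ _ _ sN fL) // rN.
Qed.

Lemma annihilator_chain N K : weakly_uniserial M -> submodule N -> submodule K ->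
  annihilator N `<=` annihilator K \/ annihilator K `<=` annihilator N.
Proof.
move=> wuM sN sK; have [e|e] := wuM N K sN sK.
  by right; apply: embeds_annihilator.
by left; apply: embeds_annihilator.
Qed.

Lemma submodule_killed N (I : set S) : submodule N -> is_ideal I ->
  submodule (N `&` [set x | forall a, I a -> a *: x = 0]).
Proof.
move=> /submoduleP [N0 NL] [_ _ IM]; apply/submoduleP.
split; first by split=> // a _; rewrite scaler0.
move=> a x y [Nx Ix] [Ny Iy]; split=> [|b Ib]; first exact: NL.
rewrite scalerDr scalerA Ix ?Iy ?addr0 //.
by have [] := IM a b Ib.
Qed.

Lemma semiprime_annihilator_prime N : weakly_uniserial M -> nonzero_submodule N ->
  is_semiprime_ideal (annihilator N) -> is_prime_ideal (annihilator N).
Proof.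
move=> wuM nzN [idP spP]; have sN := proj1 nzN.
split=> // [|I J idI idJ /ideal_mul_subE -/(_ idP) IJP]; first exact: annihilator_proper.
have JIP b a : J b -> I a -> annihilator N (b * a).
  have sIJP : I `&` J `<=` annihilator N.
    apply: spP; first exact: is_ideal_setI.
    by apply/ideal_mul_subE => // c d [Ic _] [_ Jd]; apply: IJP.
  case: idI idJ => _ _ IM [_ _ JM] Jb Ia; apply: sIJP.
  by split; [have [] := IM b a Ia | have [] := JM a b Jb].
have Nz := fun a x => @submoduleZ N a x sN.
have [sKL|sLK] := annihilator_chain _ _ wuM
  (submodule_killed N I sN idI) (submodule_killed N J sN idJ).
(* For [b] in [I], [b *: x] is killed by [J] since [JI] kills [N]; and [a] in [I] annihilates the
   part of [N] killed by [I], hence by [sKL] the part killed by [J]. *)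
- left; apply: spP => //; apply/ideal_mul_subE => // a b Ia Ib x Nx.
  rewrite -scalerA; apply: (sKL a _ (b *: x)) => [y [_]|]; first exact.
  by split=> [|c Jc]; [exact: Nz | rewrite scalerA JIP].
- right; apply: spP => //; apply/ideal_mul_subE => // a b Ja Jb x Nx.
  rewrite -scalerA; apply: (sLK a _ (b *: x)) => [y [_]|]; first exact.
  by split=> [|c Ic]; [exact: Nz | rewrite scalerA IJP].
Qed.

End Annihilators.

(** * Right modules and the four statements *)

Lemma Ann_ideal {R : nzRingType} {M : lmodType R^c} (N : set M) :
  submodule N -> is_ideal (Ann N).
Proof. by move=> /annihilator_ideal idN; apply/is_ideal_converse. Qed.

Lemma prime_submodule_max {R : nzRingType} {M : lmodType R^c} (N K : set M) :
  weakly_uniserial M -> prime_submodule N -> nonzero_submodule K ->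
  Ann K `<=` Ann N.
Proof.
move=> wuM [[sN _] prN] nzK; have [e|e] := wuM N K sN (proj1 nzK).
  exact: (embeds_annihilator _ _ sN e).
(* [L] is a copy of [K] inside [N], so primeness of [N] gives [Ann N = Ann L]. *)
have [L [nzL sLN sKL]] := embeds_image _ _ nzK e.
by rewrite (prN L nzL sLN).
Qed.

Theorem proposition2p8 (R : nzRingType) :
  (* (a) *)
  (forall M : lmodType R^c, weakly_uniserial M ->
     Ass M #<= `I_1 /\
     (acc_ideals R -> (exists x : M, x <> 0) -> Ass M #= `I_1)) /\
  (* (b) *)
  (forall M : lmodType R^c, weakly_uniserial M ->
     forall N : set M, prime_submodule N ->
       maximal_member (Ann_nonzero_submodules M) (Ann N)) /\
  (* (c) *)
  (forall M : lmodType R^c, weakly_uniserial M ->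
     (weakly_prime_module M <-> semiprime_module M)) /\
  (* (d) *)
  (right_weakly_uniserial R -> (prime_ring R <-> semiprime_ring R)) /\
  (left_weakly_uniserial R -> (prime_ring R <-> semiprime_ring R)).
Proof.
split=> [M wuM|].
  have AssT P Q : Ass M P -> Ass M Q -> P = Q.
    move=> [_ [N [prN ->]]] [_ [K [prK ->]]].
    by apply/seteqP; split; apply: prime_submodule_max => //;
      [case: prN | case: prK].
  have sub1 P : Ass M P -> Ass M `<=` [set P] by move=> AP Q AQ; apply: AssT.
  split=> [|accR Mx].
    have [[P AP]|/forallNP A0] := pselect (exists P, Ass M P).
      rewrite -(card_le_eqr (@card_set1 _ P)).
      exact/subset_card_le/sub1.
    by have -> : Ass M = set0; [rewrite -subset0 => P /A0 | exact: card_ge0].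
  have nzT := nonzero_submoduleT Mx.
  have [||P [[K nzK <-] maxK]] := exists_maximal_ideal (Ann_nonzero_submodules M) accR.
  - by move=> _ [K [sK _] <-]; apply: Ann_ideal.
  - by exists (Ann [set: M]), [set: M].
  (* A nonzero submodule [L] of [K] has an annihilator containing [Ann K], so maximality forces
     equality and [K] is prime. *)
  have AK : Ass M (Ann K).
    split; first by apply: Ann_ideal; case: nzK.
    exists K; split=> //; split=> // L nzL sLK.
    by apply/esym/maxK; [exists L | apply: (annihilatorS _ _ sLK)].
  suff -> : Ass M = [set Ann K] by apply: card_set1.
  by apply/seteqP; split=> [|_ ->]; [exact: sub1 | ].
split=> [M wuM N prN|].
  split=> [|_ [K nzK <-] sNK]; first by exists N => //; case: prN.
  by apply/seteqP; split=> //; apply: prime_submodule_max.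
split=> [M wuM|].
  split=> [wp N nzN|sp N nzN]; first exact/prime_ideal_semiprime/wp.
  apply: prime_ideal_converse.
  exact: (semiprime_annihilator_prime _ wuM nzN (semiprime_ideal_converse _ (sp N nzN))).
have one_neq0 : (1 : R) <> 0 by apply/eqP/oner_neq0.
split=> wuR; split=> [|spR]; try exact: prime_ideal_semiprime.
(* An element that annihilates the whole ring kills 1, hence is 0. *)
- have ann0 : annihilator [set: R^c^o] = [set (0 : R)].
    apply/seteqP; split=> [r /(_ 1 I)|_ -> x _]; last exact: scale0r.
    by rewrite /GRing.scale /= mulr1.
  apply: prime_ideal_converse; rewrite -ann0.
  apply: semiprime_annihilator_prime => //.
    by apply: nonzero_submoduleT; exists 1.
  by rewrite ann0; apply: semiprime_ideal_converse.
(* On the left the scalars are [R] itself, so no passage to [R^c] is made. *)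
- have ann0 : annihilator [set: R^o] = [set (0 : R)].
    apply/seteqP; split=> [r /(_ 1 I)|_ -> x _]; last exact: scale0r.
    by rewrite /GRing.scale /= mulr1.
  rewrite /prime_ring -ann0.
  apply: semiprime_annihilator_prime => //.
    by apply: nonzero_submoduleT; exists 1.
  by rewrite ann0.
Qed.
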